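(* Let $\mathscr A=\{a_1,a_2,\ldots\}$, with $a_1<a_2<\cdots$, be a strongly subconvex $L^p$-set with $1\leq p<2$. Let $k\geq 2$, let $(\alpha_0,\alpha_1,\ldots,\alpha_k)\in\mathbb R^{k+1}$, and put $\psi(x)=\alpha_kx^k+\cdots+\alpha_1x+\alpha_0$. If at least one of the coefficients $\alpha_2,\ldots,\alpha_k$ is irrational, then the sequence $(\psi(a_n))_{n=1}^\infty$ is equidistributed modulo $1$.
   Context: For $\mathscr A\subseteq\mathbb N$ and $N\geq 1$ write $\mathscr A(N)=\mathscr A\cap[1,N]$ and $A(N)=\mathrm{card}(\mathscr A(N))$; $e(z)=e^{2\pi i z}$. For $p>0$ put $I_p(N;\mathscr A)=\int_0^1\bigl|\sum_{n\in\mathscr A(N)}e(n\alpha)\bigr|^p\,d\alpha$. A non-empty set $\mathscr A\subseteq\mathbb N$ is a strongly subconvex $L^p$-set if $0<p<2$ and, for all real $N$ sufficiently large in terms of $p$, $I_p(N;\mathscr A)\ll N^{-1}A(N)^p$ with implied constant independent of $N$. A real sequence $(s_n)$ is equidistributed modulo 1 if for all $0\leq a<b\leq 1$, $\lim_{N\to\infty}N^{-1}\mathrm{card}\{1\leq n\leq N: a\leq\{s_n\}\leq b\}=b-a$, where $\{x\}=x-\lfloor x\rfloor$. *)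

(* Defs.v *)
From mathcomp Require Import all_boot all_order all_algebra finmap.
From mathcomp Require Import all_classical all_reals all_analysis.
From mathcomp Require Import complex.

Set Implicit Arguments.
Unset Strict Implicit.
Unset Printing Implicit Defensive.

Import Order.TTheory GRing.Theory Num.Theory.
Import numFieldNormedType.Exports.

Local Open Scope classical_set_scope.
Local Open Scope ring_scope.

(* Only meaningful for finite S: [fset_set] sends an infinite set to the
   empty one. It is applied below to bounded sets only. *)
Definition card (S : set nat) : nat := #|` fset_set S|%fset.

(* A(N) = A `&` [1, N]; the bound N is a real number. *)
Definition upto {R : realType} (A : set nat) (N : R) : set nat :=
  A `&` [set n : nat | (1 <= n)%N /\ n%:R <= N].

(* e(z) = exp (2 pi i z), by Euler's formula, as R[i] carries no complex
   exponential; only real arguments z are needed. *)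
Definition e_unit {R : realType} (z : R) : R[i] :=
  Complex (cos (2 * pi * z)) (sin (2 * pi * z)).

Definition exp_sum {R : realType} (A : set nat) (N alpha : R) : R[i] :=
  \sum_(n \in upto A N) e_unit (n%:R * alpha).

(* The generic norm of R[i] takes its values in R[i]; [normc] is the same
   modulus, with values in R. *)
Definition moment {R : realType} (p N : R) (A : set nat) : R :=
  \int[lebesgue_measure]_(alpha in `[0, 1])
     (ComplexField.Normc.normc (exp_sum A N alpha) `^ p).

Definition strongly_subconvex {R : realType} (p : R) (A : set nat) : Prop :=
  [/\ A !=set0, 0 < p < 2 &
      exists C N0 : R, 0 < C /\ forall N : R, N0 <= N ->
        moment p N A <= C * (N^-1 * (card (upto A N))%:R `^ p)].

Definition frac {R : realType} (x : R) : R := x - (Num.floor x)%:~R.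

(* The sequence is (s n) for n >= 1: the value [s 0] is never used. *)
Definition equidistributed_mod1 {R : realType} (s : nat -> R) : Prop :=
  forall a b : R, 0 <= a -> a < b -> b <= 1 ->
    (fun N : nat =>
       N%:R^-1 * (card [set n | (1 <= n <= N)%N /\ a <= frac (s n) <= b])%:R : R)
      @ \oo --> b - a.

(* Main.v *)
(** Put F(x) = sum_{n <= N} e(psi(n) + n x) and f(x) = sum_{m in A(N)} e(m x). By
    orthogonality sum_{m in A(N)} e(psi(m)) is the integral over [0, 1] of F times
    the conjugate of f. Weyl differencing removes the linear term, so
    F(x) = o(N) uniformly in x as soon as some coefficient of degree >= 2 is
    irrational. With u = |f| / A(N) and v = |F| / N, the smallness of v gives
    u v <= eps (u^p + v^2) because p < 2; integrating, the moment hypothesis for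
    u^p and Parseval's identity for v^2 yield o(A(N)) for the sum over A(N).
    Weyl's criterion, proved with the Fejer kernel on a finite grid, concludes.

    All exponential sums are handled through sums of cosines with an arbitrary
    phase gamma: a bound uniform in gamma is a bound for the modulus. *)

Require Import Defs.
From mathcomp Require Import all_boot all_order all_algebra.
From mathcomp Require Import all_classical all_reals all_analysis.
From mathcomp Require Import complex.
From mathcomp Require Import measurable_realfun ring lra zify.

Set Implicit Arguments.
Unset Strict Implicit.
Unset Printing Implicit Defensive.

Import Order.TTheory GRing.Theory Num.Theory.
Import numFieldNormedType.Exports.

Local Open Scope classical_set_scope.
Local Open Scope ring_scope.

(** * Cosine sums and van der Corput's inequality *)

(* The real and imaginary parts of e(x). *)
Definition cosT {R : realType} (x : R) : R := cos (2 * pi * x).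
Definition sinT {R : realType} (x : R) : R := sin (2 * pi * x).

Lemma cosTD (R : realType) (x y : R) :
  cosT (x + y) = cosT x * cosT y - sinT x * sinT y.
Proof. by rewrite /cosT mulrDr cosD. Qed.

Lemma sinTD (R : realType) (x y : R) :
  sinT (x + y) = sinT x * cosT y + cosT x * sinT y.
Proof. by rewrite /sinT mulrDr sinD. Qed.

Lemma cosTN (R : realType) (x : R) : cosT (- x) = cosT x.
Proof. by rewrite /cosT mulrN cosN. Qed.

Lemma sinTN (R : realType) (x : R) : sinT (- x) = - sinT x.
Proof. by rewrite /sinT mulrN sinN. Qed.

Lemma cosTB (R : realType) (x y : R) :
  cosT (x - y) = cosT x * cosT y + sinT x * sinT y.
Proof. by rewrite cosTD cosTN sinTN mulrN opprK. Qed.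

Lemma sinTB (R : realType) (x y : R) :
  sinT (x - y) = sinT x * cosT y - cosT x * sinT y.
Proof. by rewrite sinTD cosTN sinTN mulrN. Qed.

Lemma cosT2DsinT2 (R : realType) (x : R) : cosT x ^+ 2 + sinT x ^+ 2 = 1.
Proof. exact: cos2Dsin2. Qed.

Lemma cosT0 (R : realType) : cosT (0 : R) = 1.
Proof. by rewrite /cosT mulr0 cos0. Qed.

Lemma normr_cosT (R : realType) (x : R) : `|cosT x| <= 1.
Proof. exact: cos_max. Qed.

Lemma normr_sinT (R : realType) (x : R) : `|sinT x| <= 1.
Proof. exact: sin_max. Qed.

Lemma cosT_periodic (R : realType) (x : R) (z : int) :
  cosT (x + z%:~R) = cosT x.
Proof.
have P (m : nat) (y : R) : cosT (y + m%:R) = cosT y.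
  rewrite /cosT mulrDr -[in RHS](periodicn (@cosD2pi R) m).
  by congr (cos (_ + _)); rewrite -[pi *+ 2 *+ m]mulr_natr -[pi *+ 2]mulr_natr; ring.
case: z => m; first by rewrite P.
by rewrite NegzE rmorphN -[LHS](P m.+1) addrNK.
Qed.

Lemma sinTE (R : realType) (x : R) : sinT x = cosT (x - 4^-1).
Proof. by rewrite /sinT /cosT -cosBpihalf; congr cos; field. Qed.

Lemma sinT_periodic (R : realType) (x : R) (z : int) :
  sinT (x + z%:~R) = sinT x.
Proof. by rewrite !sinTE addrAC cosT_periodic. Qed.

(** The fractional part [f] of [x] satisfies [cosT f = cosT x = 1], hence sin(pi f) = 0, whereas sin
    is positive on (0, pi); so [f] cannot lie in (0, 1). For irrational x this keeps sin(pi x) away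
    from 0. *)
Lemma sinT_half_eq0 (R : realType) (x : R) :
  sinT (x / 2) = 0 -> x = (Num.floor x)%:~R.
Proof.
have cE (y : R) : cosT y = 1 - 2 * sinT (y / 2) ^+ 2.
  by rewrite {1}(splitr y) cosTD; have := cosT2DsinT2 (y / 2); lra.
move=> s0; pose f := x - (Num.floor x)%:~R.
have [f0 f1] : 0 <= f /\ f < 1.
  by rewrite subr_ge0 ltrBlDl floor_le -intrD1 floorD1_gt.
suff /eqP : f = 0 by rewrite subr_eq0 => /eqP.
apply/eqP; rewrite eq_le f0 andbT leNgt; apply/negP => fgt0.
have : sinT (f / 2) ^+ 2 = 0.
  have := cE f; rewrite -(cosT_periodic f (Num.floor x)) subrK (cE x) s0.
  by move=> ?; lra.
move/eqP; rewrite expf_eq0 /= => /eqP.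
have pi0 := pi_gt0 R.
have : 0 < sin (2 * pi * (f / 2)).
  rewrite sin_gt0_pi //; apply/andP; split.
    by rewrite (_ : 2 * _ * _ = pi * f); [exact: mulr_gt0|field].
  by rewrite (_ : 2 * _ * _ = pi * f); [rewrite gtr_pMr|field].
by rewrite -/(sinT _) => /[swap] ->; rewrite ltxx.
Qed.

(** The sum of the first N + q terms can be split after N terms or after q terms; comparing the two
    splittings leaves only boundary terms. *)
Lemma sum_shift (R : realType) (u : nat -> R) (q N : nat) :
  \sum_(n < N) (u (n + q)%N - u n) = \sum_(n < q) (u (N + n)%N - u n).
Proof.
rewrite !sumrB; apply/eqP; rewrite subr_eq addrAC eq_sym subr_eq; apply/eqP.
have E m n : \sum_(i < m) u i + \sum_(i < n) u (m + i)%N = \sum_(i < m + n) u i.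
  by rewrite big_split_ord.
rewrite addrC E addnC -E addrC; congr (_ + _).
by apply: eq_bigr => i _; congr u; exact: addnC.
Qed.

Lemma sum_shift_le (R : realType) (u : nat -> R) (q N : nat) :
  (forall n, `|u n| <= 1) ->
  `|\sum_(n < N) u (n + q)%N - \sum_(n < N) u n| <= 2 * q%:R.
Proof.
move=> u1; rewrite -sumrB sum_shift (le_trans (ler_norm_sum _ _ _)) //.
rewrite mulrC mulr_natl -[in leRHS](card_ord q) -sumr_const; apply: ler_sum => i _.
by rewrite (le_trans (ler_normB _ _)) // (natrD _ 1 1) lerD.
Qed.

(** From 2 sin(A) cos(B) = sin(B + A) - sin(B - A). A general step [q] and an integer error are
    allowed so that polynomials with rational higher coefficients are covered: they are linear
    modulo 1 along steps of a common denominator. *)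
Lemma sum_cosT_telescope (R : realType) (g : nat -> R) (q N : nat)
    (theta gamma : R) :
  (forall n, exists z : int, g (n + q)%N = g n + theta + z%:~R) ->
  2 * (sinT (theta / 2) * \sum_(n < N) cosT (g n + gamma)) =
  \sum_(n < N) sinT (g (n + q)%N + gamma - theta / 2) -
  \sum_(n < N) sinT (g n + gamma - theta / 2).
Proof.
move=> gq; rewrite !mulr_sumr -sumrB; apply: eq_bigr => n _.
have [z ->] := gq n.
rewrite (_ : g n + _ + _ + _ - _ = g n + gamma + theta / 2 + z%:~R); last by field.
by rewrite sinT_periodic sinTD sinTB; ring.
Qed.

Lemma sum_cosT_le (R : realType) (g : nat -> R) (q N : nat) (theta gamma : R) :
  (forall n, exists z : int, g (n + q)%N = g n + theta + z%:~R) ->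
  `|sinT (theta / 2) * \sum_(n < N) cosT (g n + gamma)| <= q%:R.
Proof.
move=> gq.
suff : `|2 * (sinT (theta / 2) * \sum_(n < N) cosT (g n + gamma))| <= 2 * q%:R.
  by rewrite normrM ger0_norm // ler_pM2l.
rewrite (sum_cosT_telescope _ _ gq).
apply: (@sum_shift_le R (fun n => sinT (g n + gamma - theta / 2))) => n.
exact: normr_sinT.
Qed.

(** Expand the nonnegative double sum of (y_i - y_j)^2. *)
Lemma cauchy_schwarz_sum (R : realType) (N : nat) (y : 'I_N -> R) :
  (\sum_n y n) ^+ 2 <= N%:R * \sum_n y n ^+ 2.
Proof.
have : 0 <= \sum_i \sum_j (y i - y j) ^+ 2.
  by do 2!apply: sumr_ge0 => ? _; exact: sqr_ge0.
have -> : \sum_i \sum_j (y i - y j) ^+ 2 =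
    2 * (N%:R * \sum_n y n ^+ 2) - 2 * (\sum_n y n) ^+ 2.
  under eq_bigr => i _ do
    under eq_bigr => j _ do rewrite sqrrB addrAC -mulr_natl.
  under eq_bigr => i _ do
    rewrite sumrB big_split /= sumr_const card_ord -!mulr_sumr.
  rewrite sumrB big_split /= -!mulr_sumr sumr_const card_ord -mulr_suml.
  rewrite sumrMnl -[_ *+ N]mulr_natl; ring.
by move=> ?; lra.
Qed.

Lemma sqr_sum_cosT (R : realType) (I : finType) (x : I -> R) :
  (\sum_h cosT (x h)) ^+ 2 + (\sum_h sinT (x h)) ^+ 2 =
  \sum_h \sum_k cosT (x h - x k).
Proof.
rewrite !expr2 !big_distrlr -big_split /=; apply: eq_bigr => h _.
by rewrite -big_split; apply: eq_bigr => k _; rewrite cosTB.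
Qed.

(** Cauchy-Schwarz in n, then completing each squared cosine sum to a squared modulus, brings in the
    differences x(n + h) - x(n + k). The H diagonal pairs contribute N each, and all H^2 pairs are
    allotted E. *)
Lemma van_der_corput (R : realType) (x : nat -> R) (H N : nat) (E : R) :
  (forall h k : 'I_H, h != k ->
     \sum_(n < N) cosT (x (n + h)%N - x (n + k)%N) <= E) ->
  0 <= E ->
  (\sum_(n < N) \sum_(h < H) cosT (x (n + h)%N)) ^+ 2 <=
    N%:R * (H%:R * N%:R + H%:R ^+ 2 * E).
Proof.
move=> hE E0; apply: le_trans (cauchy_schwarz_sum _) _; rewrite ler_wpM2l //.
have : \sum_(n < N) (\sum_(h < H) cosT (x (n + h)%N)) ^+ 2 <=
    \sum_(n < N) \sum_(h < H) \sum_(k < H) cosT (x (n + h)%N - x (n + k)%N).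
  apply: ler_sum => n _.
  by rewrite -sqr_sum_cosT lerDl sqr_ge0.
move/le_trans; apply.
rewrite exchange_big /=; under eq_bigr => h _ do rewrite exchange_big /=.
have : \sum_(h < H) \sum_(k < H) \sum_(n < N) cosT (x (n + h)%N - x (n + k)%N)
    <= \sum_(h < H) \sum_(k < H) ((if h == k then N%:R else 0) + E).
  apply: ler_sum => h _; apply: ler_sum => k _.
  case: eqVneq => [<-|hk]; last by rewrite add0r; exact: hE.
  under eq_bigr => n _ do rewrite subrr cosT0.
  by rewrite sumr_const card_ord lerDl.
move/le_trans; apply.
rewrite (eq_bigr (fun=> N%:R + H%:R * E)) => [|h _].
  by rewrite sumr_const card_ord -[_ *+ H]mulr_natl; lra.
rewrite big_split /= -big_mkcond (big_pred1 h) => [|k]; last exact: eq_sym.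
by rewrite sumr_const card_ord -[_ *+ H]mulr_natl.
Qed.

Definition small_sums {R : realType} (g : nat -> R) : Prop :=
  forall eps : R, 0 < eps -> exists N0 : nat, forall N : nat, (N0 <= N)%N ->
    forall gamma : R, `|\sum_(n < N) cosT (g n + gamma)| <= eps * N%:R.

(** The threshold is chosen before [beta]: later [beta] is the variable of integration. *)
Definition small_twisted_sums {R : realType} (g : nat -> R) : Prop :=
  forall eps : R, 0 < eps -> exists N0 : nat, forall N : nat, (N0 <= N)%N ->
    forall beta gamma : R,
      `|\sum_(n < N) cosT (g n + n%:R * beta + gamma)| <= eps * N%:R.

(** * Weyl sums of polynomials *)

Lemma le_mul_truncnS (R : realType) (x c : R) (N : nat) :
  0 < c -> ((Num.truncn (x / c)).+1 <= N)%N -> x <= c * N%:R.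
Proof.
move=> c0 cN; rewrite -ler_pdivrMl // mulrC ltW //.
by rewrite (lt_le_trans (truncnS_gt _)) // ler_nat.
Qed.

(** In the difference of the phases at n + h and n + k the twist contributes only the constant (h -
    k) beta, which the uniformity in the phase absorbs. Moving the origin of summation by k costs at
    most 2H. *)
Lemma small_sums_shift_diff (R : realType) (g : nat -> R) :
  (forall d, (0 < d)%N -> small_sums (fun n => g (n + d)%N - g n)) ->
  forall (eps : R) (H : nat), 0 < eps -> exists N0 : nat, forall N, (N0 <= N)%N ->
    forall (beta gamma : R) (h k : 'I_H), h != k ->
    \sum_(n < N) cosT ((g (n + h)%N + (n + h)%:R * beta + gamma) -
                       (g (n + k)%N + (n + k)%:R * beta + gamma)) <= eps * N%:R + 2 * H%:R.
Proof.
move=> gS eps H e0.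
(* One threshold per difference d < H; the maximum of these serves all pairs. The value at d = 0 is
   a dummy. *)
have /choice [N1 N1P] (d : nat) : exists N0 : nat, forall N, (N0 <= N)%N ->
    (0 < d)%N -> forall c : R,
    `|\sum_(n < N) cosT (g (n + d)%N - g n + c)| <= eps * N%:R.
  have [->|d0] := posnP d; first by exists 0%N.
  by have [N0 N0P] := gS d d0 eps e0; exists N0 => N /N0P.
exists (\max_(d < H) N1 d) => N NN1 beta gamma h k hk.
pose x n := g n + n%:R * beta + gamma.
change (\sum_(n < N) cosT (x (n + h)%N - x (n + k)%N) <= eps * N%:R + 2 * H%:R).
wlog kh : h k hk / (k < h)%N => [W|].
  have [kh|hk'|] := ltngtP k h; first exact: (W h k).
  - rewrite (eq_bigr (fun n : 'I_N => cosT (x (n + k)%N - x (n + h)%N))).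
      by apply: (W k h) => //; rewrite eq_sym.
    by move=> n _; rewrite -cosTN opprB.
  - by move/val_inj => e; rewrite e eqxx in hk.
pose d := (h - k)%N.
have d0 : (0 < d)%N by rewrite subn_gt0.
have dH : (d < H)%N by rewrite (leq_ltn_trans (leq_subr _ _)).
pose u n := cosT (g (n + d)%N - g n + d%:R * beta).
have -> : \sum_(n < N) cosT (x (n + h)%N - x (n + k)%N) = \sum_(n < N) u (n + k)%N.
  apply: eq_bigr => n _; rewrite /u /x -addnA subnKC ?(ltnW kh) //.
  congr cosT; rewrite /d natrB ?(ltnW kh) // !natrD; ring.
have := @sum_shift_le R u k N (fun n => normr_cosT _).
have := N1P d N (leq_trans (leq_bigmax (Ordinal dH)) NN1) d0 (d%:R * beta).
have : k%:R <= H%:R :> R by rewrite ler_nat ltnW.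
rewrite -/(u _) => kH /ler_normlW A /ler_normlW B.
have {}A : \sum_(n < N) u n <= eps * N%:R by exact: A.
lra.
Qed.

Lemma small_twisted_sums_diff (R : realType) (g : nat -> R) :
  (forall d, (0 < d)%N -> small_sums (fun n => g (n + d)%N - g n)) ->
  small_twisted_sums g.
Proof.
move=> gS eta eta0.
(* The constants make each of the three terms of van der Corput's bound, N * HN, N * H^2 (eta^2 /
   12) N and N * 2H^3, at most (eta H N)^2 / 12. Their sum is then at most (eta H N / 2)^2. *)
pose H := (Num.truncn (12 / eta ^+ 2)).+1.
have H0 : 0 < H%:R :> R by rewrite ltr0n.
have HE : 12 <= eta ^+ 2 * H%:R by apply: le_mul_truncnS; rewrite ?exprn_gt0.
have e0 : 0 < eta ^+ 2 / 12 by rewrite divr_gt0 ?exprn_gt0.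
have [N1 N1P] := small_sums_shift_diff gS H e0.
pose N2 := (Num.truncn (4 * H%:R / eta)).+1.
pose N3 := (Num.truncn (24 * H%:R / eta ^+ 2)).+1.
exists (maxn N1 (maxn N2 N3)) => N; rewrite !geq_max => /and3P[NN1 NN2 NN3].
have {}NN2 : 4 * H%:R <= eta * N%:R by exact: le_mul_truncnS.
have {}NN3 : 24 * H%:R <= eta ^+ 2 * N%:R.
  by apply: le_mul_truncnS; rewrite ?exprn_gt0.
move=> beta gamma; pose x n := g n + n%:R * beta + gamma.
rewrite -/(x _) -[X in `|X|]/(\sum_(n < N) cosT (x n)).
set S := \sum_(n < N) _.
set W := \sum_(n < N) \sum_(h < H) cosT (x (n + h)%N).
(* Each of the H shifted sums differs from [S] by at most 2H; the condition 4H <= eta N makes the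
   total error at most eta H N / 2. *)
have WS : `|W - H%:R * S| <= 2 * H%:R ^+ 2.
  rewrite /W exchange_big /= mulr_natl -[in X in S *+ X](card_ord H) -sumr_const.
  rewrite -sumrB (le_trans (ler_norm_sum _ _ _)) //.
  have : \sum_(h < H) `|\sum_(n < N) cosT (x (n + h)%N) - S| <=
      \sum_(h < H) 2 * H%:R.
    apply: ler_sum => h _.
    have := @sum_shift_le R (cosT \o x) h N (fun n => normr_cosT _).
    by move/le_trans; apply; rewrite ler_pM2l // ler_nat ltnW.
  move/le_trans; apply.
  by rewrite sumr_const card_ord -[2 * _ *+ _]mulr_natl expr2 mulrCA.
have W2 : W ^+ 2 <= (eta * H%:R * N%:R / 2) ^+ 2.
  have := @van_der_corput R x H N _ (N1P N NN1 beta gamma).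
  have E0 : 0 <= eta ^+ 2 / 12 * N%:R + 2 * H%:R.
    by rewrite addr_ge0 // mulr_ge0 // ltW.
  move/(_ E0)/le_trans; apply.
  have N0 : 0 <= N%:R :> R by [].
  have A1 : H%:R * N%:R * 12 <= H%:R * N%:R * (eta ^+ 2 * H%:R).
    by rewrite ler_wpM2l // mulr_ge0 // ltW.
  have A2 : H%:R ^+ 2 * (24 * H%:R) <= H%:R ^+ 2 * (eta ^+ 2 * N%:R).
    by rewrite ler_wpM2l // exprn_ge0 // ltW.
  rewrite (_ : (_ / 2) ^+ 2 = N%:R * (eta ^+ 2 * H%:R ^+ 2 * N%:R / 4)); last by field.
  by rewrite ler_wpM2l //; lra.
have {}W2 : `|W| <= eta * H%:R * N%:R / 2.
  rewrite -ler_sqr ?real_normK ?num_real // nnegrE.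
  by rewrite divr_ge0 // !mulr_ge0 // ltW.
rewrite -(ler_pM2l H0) -[X in X * `|S|](ger0_norm (ltW H0)) -normrM.
have -> : H%:R * S = W - (W - H%:R * S) by ring.
rewrite (le_trans (ler_normB _ _)) //.
have : H%:R * (4 * H%:R) <= H%:R * (eta * N%:R) by rewrite ler_pM2l.
by move: WS W2; rewrite expr2; lra.
Qed.

Lemma small_twisted_sumsW (R : realType) (g : nat -> R) :
  small_twisted_sums g -> small_sums g.
Proof.
move=> gS eps /gS[N0 N0P]; exists N0 => N /N0P /(_ 0) S gamma.
by have := S gamma; under eq_bigr => n _ do rewrite mulr0 addr0.
Qed.

(** * Rational and irrational coefficients under differencing *)

Lemma rational0 (R : realType) : rational (0 : R).
Proof. by exists 0; rewrite ?rmorph0. Qed.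

Lemma rationalD (R : realType) (x y : R) :
  rational x -> rational y -> rational (x + y).
Proof. by move=> [q _ <-] [r _ <-]; exists (q + r); rewrite ?rmorphD. Qed.

Lemma rationalM (R : realType) (x y : R) :
  rational x -> rational y -> rational (x * y).
Proof. by move=> [q _ <-] [r _ <-]; exists (q * r); rewrite ?rmorphM. Qed.

Lemma rational_int (R : realType) (z : int) : rational (z%:~R : R).
Proof. by exists z%:~R; rewrite ?ratr_int. Qed.

Lemma rational_nat (R : realType) (n : nat) : rational (n%:R : R).
Proof. exact: (rational_int R n). Qed.

Lemma rational_sum (R : realType) (I : Type) (r : seq I) (P : pred I) (F : I -> R) :
  (forall i, P i -> rational (F i)) -> rational (\sum_(i <- r | P i) F i).
Proof.
move=> FP; apply: big_ind => //; first exact: rational0.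
exact: rationalD.
Qed.

Lemma rational_cancelM (R : realType) (x : R) (n : nat) :
  (0 < n)%N -> rational (n%:R * x) -> rational x.
Proof.
move=> n0 [q _ qE]; exists (n%:R^-1 * q) => //.
by rewrite rmorphM fmorphV rmorph_nat /= qE mulrA mulVf ?mul1r // pnatr_eq0 -lt0n.
Qed.

(* Taylor expansion of p(X + d) - p(X); see [horner_diff_poly]. *)
Definition diff_poly {R : nzRingType} (d : nat) (p : {poly R}) : {poly R} :=
  \sum_(i < size p) d%:R ^+ i.+1 *: p^`N(i.+1).

Lemma horner_diff_poly (R : comNzRingType) (d n : nat) (p : {poly R}) :
  (diff_poly d p).[n%:R] = p.[(n + d)%:R] - p.[n%:R].
Proof.
rewrite /diff_poly horner_sum natrD nderiv_taylor; last exact: mulrC.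
have [->|p0] := eqVneq p 0.
  by rewrite size_poly0 !big_ord0 horner0 subr0.
(* Adding the vanishing derivative of order [size p] makes the range match that of [diff_poly] once
   the term of order 0 is split off. *)
have E : \sum_(i < (size p).+1) p^`N(i).[n%:R] * d%:R ^+ i =
         \sum_(i < size p) p^`N(i).[n%:R] * d%:R ^+ i.
  rewrite big_ord_recr /= nderivn_poly0 ?size_poly ?leqnn //.
  by rewrite horner0 mul0r addr0.
rewrite -E big_ord_recl /= nderivn0 expr0 mulr1 addrAC subrr add0r.
by apply: eq_bigr => i _; rewrite hornerZ mulrC.
Qed.

Lemma coef_diff_poly (R : nzRingType) (d m : nat) (p : {poly R}) :
  (diff_poly d p)`_m =
  \sum_(i < size p) d%:R ^+ i.+1 * (p`_(i.+1 + m) *+ 'C(i.+1 + m, i.+1)).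
Proof.
by rewrite coef_sum; apply: eq_bigr => i _; rewrite coefZ coef_nderivn.
Qed.

Lemma rational_term (R : realType) (d i c : nat) (y : R) :
  rational y -> rational (d%:R ^+ i * (y *+ c)).
Proof.
move=> yQ; apply: rationalM; first by rewrite -natrX; exact: rational_nat.
by rewrite -mulr_natl; apply: rationalM => //; exact: rational_nat.
Qed.

(** The coefficient of degree m of the difference involves only coefficients of [p] of degree above
    m. *)
Lemma rational_diff_poly (R : realType) (d j m : nat) (p : {poly R}) :
  (forall i, (j < i)%N -> rational p`_i) -> (j <= m)%N ->
  rational (diff_poly d p)`_m.
Proof.
move=> pQ jm; rewrite coef_diff_poly; apply: rational_sum => i _.
by apply: rational_term; apply: pQ; rewrite addSn ltnS (leq_trans jm) ?leq_addl.
Qed.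

(** The coefficient of degree j of the difference is d (j + 1) p_(j+1) plus a rational combination
    of higher coefficients, so differencing lowers the top irrational degree by exactly one. *)
Lemma irrational_diff_poly (R : realType) (d j : nat) (p : {poly R}) :
  (0 < d)%N -> irrational p`_j.+1 ->
  (forall i, (j.+1 < i)%N -> rational p`_i) ->
  irrational (diff_poly d p)`_j.
Proof.
move=> d0 pj pQ; rewrite coef_diff_poly.
case sE: (size p) => [|s].
  by case: pj; rewrite nth_default ?sE //; apply: rational0.
rewrite big_ord_recl /= expr1 add1n bin1 => S; apply: pj.
apply: (@rational_cancelM _ _ (d * j.+1)%N); first by rewrite muln_gt0 d0.
rewrite natrM -mulrA [j.+1%:R * _]mulr_natl.
set t := \sum_(_ < _) _ in S.
have tQ : rational t.
  apply: rational_sum => i _; apply: rational_term; apply: pQ.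
  by rewrite /bump; lia.
rewrite -(addrK t (d%:R * _)); apply: rationalD => //.
by rewrite -mulN1r; apply: rationalM => //; exact: (rational_int R (-1)).
Qed.

Lemma common_denominator (R : realType) (I : finType) (F : I -> R) :
  (forall i, rational (F i)) ->
  exists2 q : nat, (0 < q)%N & forall i, exists z : int, q%:R * F i = z%:~R.
Proof.
move=> FQ; have /choice[r rP] i : exists r : rat, ratr r = F i.
  by have [r _ rE] := FQ i; exists r.
exists (\prod_i `|denq (r i)|)%N => [|i].
  by rewrite prodn_cond_gt0 // => i _; rewrite absz_gt0 denq_eq0.
exists (Posz (\prod_(j | j != i) `|denq (r j)|)%N * numq (r i)).
rewrite (bigD1 i) //= natrM intrM mulrAC mulrC; congr (_ * _).
rewrite -(rP i) natr_absz gtr0_norm ?denq_gt0 // mulrC /ratr divfK //.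
by rewrite intr_eq0 denq_eq0.
Qed.

(** Irrationality gives sin(pi theta) <> 0, so telescoping bounds the sum by a constant independent
    of N and of the phase. *)
Lemma small_sums_linear (R : realType) (g : nat -> R) (q : nat) (theta : R) :
  irrational theta ->
  (forall n, exists z : int, g (n + q)%N = g n + theta + z%:~R) ->
  small_sums g.
Proof.
move=> irr gq eps e0.
have s0 : 0 < `|sinT (theta / 2)|.
  rewrite normr_gt0; apply/eqP => /sinT_half_eq0 E; apply: irr.
  by rewrite E; exact: rational_int.
exists (Num.truncn (q%:R / (`|sinT (theta / 2)| * eps))).+1 => N NN gamma.
rewrite -(ler_pM2l s0) -normrM (le_trans (sum_cosT_le _ _ gq)) // mulrA.
by apply: le_mul_truncnS; rewrite ?mulr_gt0.
Qed.

Lemma exp_add_int (R : comNzRingType) (n q j : nat) :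
  exists m : nat, (n + q)%:R ^+ j = n%:R ^+ j + (q * m)%:R :> R.
Proof.
elim: j => [|j [m mE]]; first by exists 0%N; rewrite !expr0 muln0 addr0.
exists (n ^ j + (n + q) * m)%N.
by rewrite !exprS mE !(natrD, natrM, natrX); ring.
Qed.

(** Let q be a common denominator of the coefficients of degree at least 2. Since q divides (n +
    q)^i - n^i, passing from n to n + q adds q p_1 to p(n) modulo 1, and q p_1 is irrational. *)
Lemma small_sums_poly_base (R : realType) (p : {poly R}) :
  irrational p`_1 -> (forall i, (1 < i)%N -> rational p`_i) ->
  small_sums (fun n => p.[n%:R]).
Proof.
move=> irr pQ.
(* Degrees 0 and 1 are replaced by 0 so that every value of [F] is rational. *)
pose F (i : 'I_(size p)) := if (1 < i)%N then p`_i else 0.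
have [|q q0 qF] := @common_denominator R _ F.
  by move=> i; rewrite /F; case: ifP => [/pQ //|_]; exact: rational0.
have [z zP] := choice qF.
have psz : (1 < size p)%N.
  rewrite ltnNge; apply/negP => s1.
  by apply: irr; rewrite nth_default //; exact: rational0.
apply: (@small_sums_linear _ _ q (q%:R * p`_1)).
  by move/(rational_cancelM q0) => /irr.
move=> n.
have /choice[w wP] (i : 'I_(size p)) : exists w : int, p`_i * (n + q)%:R ^+ i =
    p`_i * n%:R ^+ i + (if i == 1%N :> nat then q%:R * p`_1 else 0) + w%:~R.
  have [m mE] := exp_add_int R n q i.
  case: (ltngtP i 1) => [|i1|->].
  - by rewrite ltnS leqn0 => /eqP ->; exists 0; rewrite !addr0 !expr0.
  - exists (z i * m%:Z); rewrite intrM -zP /F i1 mE natrM; ring.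
  - by exists 0; rewrite !expr1 natrD; ring.
exists (\sum_i w i); rewrite !horner_coef (eq_bigr _ (fun i _ => wP i)).
rewrite 2!big_split /= -[X in _ + X + _]big_mkcond rmorph_sum.
by rewrite [X in _ + X + _](big_pred1 (Ordinal psz)).
Qed.

(** Induction on the top irrational degree: differencing reduces it by one until the case of degree
    1. *)
Lemma small_sums_poly (R : realType) (j : nat) (p : {poly R}) :
  irrational p`_j.+1 -> (forall i, (j.+1 < i)%N -> rational p`_i) ->
  small_sums (fun n => p.[n%:R]).
Proof.
elim: j p => [|j IH] p irr pQ; first exact: small_sums_poly_base.
apply/small_twisted_sumsW/small_twisted_sums_diff => d d0.
under eq_fun do rewrite -horner_diff_poly.
apply: IH; first exact: irrational_diff_poly.
by move=> i ji; exact: (rational_diff_poly _ pQ).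
Qed.

(** A top irrational degree of at least 2 leaves, after one differencing, an irrational coefficient
    of degree at least 1, while the twist has disappeared. *)
Lemma small_twisted_sums_poly (R : realType) (j : nat) (p : {poly R}) :
  irrational p`_j.+2 -> (forall i, (j.+2 < i)%N -> rational p`_i) ->
  small_twisted_sums (fun n => p.[n%:R]).
Proof.
move=> irr pQ; apply: small_twisted_sums_diff => d d0.
under eq_fun do rewrite -horner_diff_poly.
apply: (@small_sums_poly _ j); first exact: irrational_diff_poly.
by move=> i ji; exact: (rational_diff_poly _ pQ).
Qed.

Lemma weyl_poly_twisted (R : realType) (p : {poly R}) :
  (exists2 j, (2 <= j)%N & irrational p`_j) ->
  small_twisted_sums (fun n => p.[n%:R]).
Proof.
move=> [j0 j02 irr].
have ex : exists j, (2 <= j)%N && `[< irrational p`_j >].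
  by exists j0; rewrite j02; apply/asboolP.
have ub j : (2 <= j)%N && `[< irrational p`_j >] -> (j <= size p)%N.
  move=> /andP[_ /asboolP pj]; rewrite leqNgt; apply/negP => sj.
  by apply: pj; rewrite nth_default ?(ltnW sj) //; exact: rational0.
(* The largest degree at least 2 with an irrational coefficient; it exists because coefficients
   beyond [size p] are 0. *)
have [[|[|j]] // /andP[_ /asboolP pj] jmax] := ex_maxnP ex ub.
apply: (@small_twisted_sums_poly _ j) => // i ji.
apply: contrapT => /asboolP pi.
by have := jmax i; rewrite pi (leq_trans _ ji) // => /(_ isT); rewrite leqNgt ji.
Qed.

(** * Weyl's criterion *)

(** The squared-modulus form, rather than the quotient of sines, makes positivity immediate and is
    valid at integers too. *)
Definition fejer {R : realType} (K : nat) (x : R) : R :=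
  K%:R^-1 * ((\sum_(h < K) cosT (h%:R * x)) ^+ 2 +
             (\sum_(h < K) sinT (h%:R * x)) ^+ 2).

Lemma fejerE (R : realType) (K : nat) (x : R) :
  fejer K x = K%:R^-1 * \sum_(h < K) \sum_(k < K) cosT (h%:R * x - k%:R * x).
Proof. by rewrite /fejer sqr_sum_cosT. Qed.

Lemma fejer_ge0 (R : realType) (K : nat) (x : R) : 0 <= fejer K x.
Proof. by rewrite mulr_ge0 // ?invr_ge0 // addr_ge0 ?sqr_ge0. Qed.

Lemma sinT_half_sqr (R : realType) (x : R) :
  sinT (x / 2) ^+ 2 = (1 - cosT x) / 2.
Proof. by rewrite {2}(splitr x) cosTD; have := cosT2DsinT2 (x / 2); lra. Qed.

(** Here 1 - cos(2 pi x) = 2 sin(pi x)^2, and sin(pi x) times the real or the imaginary part of the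
    geometric sum is at most 1 in absolute value by telescoping; hence 2 (1 + 1) / K. *)
Lemma fejer_le (R : realType) (K : nat) (x : R) :
  (0 < K)%N -> (1 - cosT x) * fejer K x <= 4 / K%:R.
Proof.
move=> K0.
have gq (n : nat) : exists z : int, (n + 1)%:R * x = n%:R * x + x + z%:~R.
  by exists 0; rewrite natrD; ring.
have A := @sum_cosT_le R (fun n => n%:R * x) 1 K x 0 gq.
have B := @sum_cosT_le R (fun n => n%:R * x) 1 K x (- 4^-1) gq.
have sq (y : R) : `|y| <= 1%:R -> y ^+ 2 <= 1.
  by move=> y1; rewrite -[y ^+ 2]real_normK ?num_real // expr_le1.
have {}A : `|sinT (x / 2) * \sum_(h < K) cosT (h%:R * x)| <= 1%:R.
  by move: A; under eq_bigr do rewrite addr0.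
have {}B : `|sinT (x / 2) * \sum_(h < K) sinT (h%:R * x)| <= 1%:R.
  by move: B; under eq_bigr do rewrite -sinTE.
rewrite /fejer mulrCA mulrC ler_pM2r ?invr_gt0 ?ltr0n //.
have -> : 1 - cosT x = 2 * sinT (x / 2) ^+ 2 by rewrite sinT_half_sqr; field.
by move: (sq _ A) (sq _ B); rewrite -mulrA mulrDr -!exprMn; lra.
Qed.

(** K steps of [theta] make the integer h - k, so the two boundary terms of the telescoped sum
    agree. The factor sin(pi theta) is nonzero, since otherwise K would divide h - k although 0 < |h
    - k| < K. *)
Lemma sum_cosT_roots (R : realType) (K : nat) (c : R) (h k : 'I_K) :
  h != k -> \sum_(j < K) cosT (j%:R * ((h%:R - k%:R) / K%:R) + c) = 0.
Proof.
move=> hk; set theta := (_ - _) / _.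
have K0 : (0 < K)%N by case: (K) h {k hk theta} => [[]|].
have KR : K%:R != 0 :> R by rewrite pnatr_eq0 -lt0n.
have gq (n : nat) : exists z : int, (n + 1)%:R * theta = n%:R * theta + theta + z%:~R.
  by exists 0; rewrite natrD; ring.
have := @sum_cosT_telescope R (fun n => n%:R * theta) 1 K theta c gq.
rewrite -sumrB (@sum_shift R (fun n => sinT (n%:R * theta + c - theta / 2))).
rewrite big_ord1 addn0 mul0r add0r.
have -> : K%:R * theta = (h%:Z - k%:Z)%:~R.
  by rewrite rmorphB /= /theta mulrCA divff ?mulr1.
rewrite [_ + c]addrC addrAC sinT_periodic subrr => /eqP.
rewrite mulf_eq0 pnatr_eq0 /= mulf_eq0 => /orP[/eqP /sinT_half_eq0|/eqP //].
set z := Num.floor theta => thetaz; exfalso; move/eqP: hk; apply.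
have : (h%:Z - k%:Z) = K%:Z * z.
  apply/eqP; rewrite -(eqr_int R) rmorphB rmorphM /= -thetaz.
  by rewrite /theta mulrCA divff ?mulr1.
move=> E; apply/val_inj => /=; have := ltn_ord h; have := ltn_ord k.
have : z = 0 \/ 1 <= z \/ z <= -1 by lia.
by move: E; nia.
Qed.

(** Discrete orthogonality on the grid: only the K diagonal pairs h = k survive, each contributing
    K, and the kernel carries the factor 1 / K. *)
Lemma sum_fejer (R : realType) (K : nat) (x : R) : (0 < K)%N ->
  \sum_(j < K) fejer K (x - j%:R / K%:R) = K%:R.
Proof.
move=> K0; have KR : K%:R != 0 :> R by rewrite pnatr_eq0 -lt0n.
under eq_bigr do rewrite fejerE.
rewrite -mulr_sumr exchange_big /=; under eq_bigr do rewrite exchange_big /=.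
rewrite (eq_bigr (fun=> K%:R)) => [|h _].
  by rewrite sumr_const card_ord -[K%:R *+ K]mulr_natl mulKf.
rewrite [LHS](bigD1 h) //= [X in _ + X]big1 ?addr0 => [|k kh].
  by under eq_bigr do rewrite subrr cosT0; rewrite sumr_const card_ord.
rewrite -[RHS](@sum_cosT_roots R K ((h%:R - k%:R) * x) k h kh).
by apply: eq_bigr => j _; congr cosT; field.
Qed.

Definition weyl_sums {R : realType} (t : nat -> R) : Prop :=
  forall h, (0 < h)%N -> small_sums (fun n => h%:R * t n).

(** The diagonal pairs contribute N in total after division by K; each of the K^2 pairs is allotted
    eps N / K, which gives eps N. The centre [y] enters only as a phase, so the threshold does not
    depend on it. *)
Lemma mean_fejer_le (R : realType) (t : nat -> R) (K : nat) (eps : R) :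
  weyl_sums t -> (0 < K)%N -> 0 < eps ->
  exists N0 : nat, forall N, (N0 <= N)%N -> forall y : R,
    \sum_(n < N) fejer K (t n - y) <= (1 + eps) * N%:R.
Proof.
move=> tW K0 eps0.
have KR : 0 < K%:R :> R by rewrite ltr0n.
have e0 : 0 < eps / K%:R by rewrite divr_gt0.
have /choice [N1 N1P] (d : nat) : exists N0 : nat, forall N, (N0 <= N)%N ->
    (0 < d)%N -> forall c : R,
    `|\sum_(n < N) cosT (d%:R * t n + c)| <= eps / K%:R * N%:R.
  have [->|d0] := posnP d; first by exists 0%N.
  by have [N0 N0P] := tW d d0 _ e0; exists N0 => N /N0P.
exists (\max_(d < K) N1 d) => N NN1 y.
under eq_bigr do rewrite fejerE.
rewrite -mulr_sumr exchange_big /=; under eq_bigr do rewrite exchange_big /=.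
rewrite mulrC ler_pdivrMr //.
have hk_le (h k : 'I_K) : (k < h)%N ->
    \sum_(n < N) cosT (h%:R * (t n - y) - k%:R * (t n - y)) <= eps / K%:R * N%:R.
  move=> kh; have d0 : (0 < h - k)%N by rewrite subn_gt0.
  have dK : (h - k < K)%N by rewrite (leq_ltn_trans (leq_subr _ _)).
  have := N1P _ N (leq_trans (leq_bigmax (Ordinal dK)) NN1) d0 (- (h - k)%:R * y).
  move/ler_normlW; congr (_ <= _); apply: eq_bigr => n _; congr cosT.
  by rewrite natrB ?(ltnW kh) //; ring.
have : \sum_(h < K) \sum_(k < K)
      \sum_(n < N) cosT (h%:R * (t n - y) - k%:R * (t n - y)) <=
    \sum_(h < K) \sum_(k < K) ((if k == h then N%:R else 0) + eps / K%:R * N%:R).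
  apply: ler_sum => h _; apply: ler_sum => k _.
  case: eqVneq => [->|kh].
    under eq_bigr do rewrite subrr cosT0.
    by rewrite sumr_const card_ord lerDl mulr_ge0 // ltW.
  rewrite add0r; have [/hk_le //|hk|/val_inj/eqP] := ltngtP k h; last by rewrite (negPf kh).
  by under eq_bigr do rewrite -cosTN opprB; exact: hk_le.
move/le_trans; apply.
rewrite (eq_bigr (fun=> (1 + eps) * N%:R)) => [|h _].
  by rewrite sumr_const card_ord -[_ *+ K]mulr_natl mulrC.
rewrite big_split /= -big_mkcond (big_pred1 h) // sumr_const card_ord.
by rewrite -[_ *+ K]mulr_natl; field; rewrite gt_eqF.
Qed.

Lemma count_itv_le (R : realType) (x y : R) (K : nat) : x <= y ->
  \sum_(j < K) (x <= j%:R <= y)%R%:R <= y - x + 1 :> R.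
Proof.
move=> xy; pose c m : R := \sum_(j < m) (x <= j%:R <= y)%R%:R.
(* The induction carries a second bound: once some integer has been counted, the count up to K is at
   most K - x. *)
suff : c K <= y - x + 1 /\ (c K <= K%:R - x \/ c K = 0) by case.
elim: K => [|K [IH1 IH2]].
  by rewrite /c big_ord0; split; [lra|right].
rewrite /c big_ord_recr /= -/(c K) -natr1.
have [/andP[xK Ky]|_] := boolP (_ && _); rewrite ?addr0 //=; last first.
  by split=> //; case: IH2 => ?; [left; lra|right].
by case: IH2 => ?; split; try left; lra.
Qed.

Lemma cosT_lt1 (R : realType) (d : R) : 0 < d -> d <= 2^-1 -> cosT d < 1.
Proof.
move=> d0 d2; rewrite -(cosT0 R) /cosT; have pi0 := pi_gt0 R.
rewrite ltr_cos ?mulr0 ?mulr_gt0 // in_itv /= ?lexx ?(ltW pi0) //.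
by rewrite mulr_ge0 ?mulr_ge0 ?(ltW pi0) ?(ltW d0) //=; nra.
Qed.

(** Evenness and periodicity reduce to [0, 1/2], where the cosine decreases. *)
Lemma cosT_le_away (R : realType) (d w : R) : 0 <= d -> d <= 2^-1 ->
  d <= `|w| <= 1 - d -> cosT w <= cosT d.
Proof.
move=> d0 d2.
have pi0 := pi_gt0 R.
have half (v : R) : d <= v -> v <= 2^-1 -> cosT v <= cosT d.
  move=> dv v2; have v0 : 0 <= v by exact: le_trans dv.
  rewrite /cosT leNgt; apply/negP.
  rewrite ltr_cos; first by rewrite ltr_pM2l ?mulr_gt0 // ltNge dv.
  - by rewrite in_itv /=; apply/andP; split; [rewrite !mulr_ge0 ?(ltW pi0)|nra].
  - rewrite in_itv /=; apply/andP; split; last by nra.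
    by rewrite !mulr_ge0 ?(ltW pi0).
have -> : cosT w = cosT `|w|.
  by case: (ger0P w) => // _; rewrite cosTN.
case/andP=> dw w1; have [w2|w2] := leP `|w| 2^-1; first exact: half.
rewrite -cosTN -(cosT_periodic _ 1) addrC; apply: half; lra.
Qed.

Lemma frac_ge0 (R : realType) (x : R) : 0 <= Defs.frac x.
Proof. by rewrite subr_ge0 floor_le. Qed.

Lemma frac_lt1 (R : realType) (x : R) : Defs.frac x < 1.
Proof. by rewrite ltrBlDl -intrD1 floorD1_gt. Qed.

Lemma fejer_away_le (R : realType) (K : nat) (d x y : R) : (0 < K)%N ->
  0 < d -> d <= 2^-1 -> d <= `|Defs.frac x - y| <= 1 - d ->
  fejer K (x - y) <= 4 / (1 - cosT d) / K%:R.
Proof.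
move=> K0 d0 d2 /(cosT_le_away (ltW d0) d2).
have -> : cosT (Defs.frac x - y) = cosT (x - y).
  rewrite -(cosT_periodic _ (Num.floor x)) /Defs.frac.
  by congr cosT; rewrite addrAC subrK.
have cd := cosT_lt1 d0 d2; move=> cxy.
rewrite mulrAC ler_pdivlMr ?subr_gt0 // mulrC.
by apply: le_trans (fejer_le (x - y) K0); rewrite ler_wpM2r ?fejer_ge0 // lerB.
Qed.

Definition frac_in {R : realType} (a b x : R) : bool := a <= Defs.frac x <= b.

(** The last two ranges are neighbourhoods of 0 and 1. They catch the grid points that are close to
    [a, b] only around the circle, and are always included, at a cost of about 2dK extra points. *)
Definition near_arc {R : realType} (K : nat) (a b d : R) (j : nat) : bool :=
  [|| K%:R * (a - d) <= j%:R <= K%:R * (b + d),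
      (0 : R) <= j%:R <= K%:R * d | K%:R * (1 - d) <= j%:R <= (K%:R : R)].

(* The grid points j / K within circular distance d of [a, b] carry almost all
   the mass of the Fejer kernel centred at a point of [a, b]. *)
Lemma frac_in_le_fejer (R : realType) (K : nat) (a b d x : R) :
  (0 < K)%N -> 0 <= a -> a <= b -> b <= 1 -> 0 < d -> d <= 2^-1 ->
  (frac_in a b x)%:R * (K%:R - 4 / (1 - cosT d)) <=
    \sum_(j < K | near_arc K a b d j) fejer K (x - j%:R / K%:R).
Proof.
move=> K0 a0 ab b1 d0 d2; set near := near_arc K a b d.
have KR : 0 < K%:R :> R by rewrite ltr0n.
have [/andP[ax xb]|_] := boolP (frac_in a b x); last first.
  by rewrite mul0r sumr_ge0 // => j _; exact: fejer_ge0.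
rewrite mul1r lerBlDr -{1}(sum_fejer x K0) (bigID (fun j : 'I_K => near j)) /=.
rewrite lerD2l.
have : \sum_(j < K | ~~ near j) fejer K (x - j%:R / K%:R) <=
    \sum_(j < K) 4 / (1 - cosT d) / K%:R.
  rewrite big_mkcond; apply: ler_sum => j _; case: ifP => [|_]; last first.
    by rewrite !divr_ge0 // subr_ge0 ltW // cosT_lt1.
  rewrite !negb_or !negb_and -!ltNge => /and3P[j1 j2 j3].
  apply: fejer_away_le => //.
  have jK : j%:R <= K%:R :> R by rewrite ler_nat ltnW.
  have [y jy] : exists y : R, j%:R = K%:R * y.
    by exists (j%:R / K%:R); rewrite mulrC divfK // gt_eqF.
  have j0 : 0 <= j%:R :> R by [].
  move: jK j1 j2 j3 j0; rewrite jy mulrAC divff ?gt_eqF // mul1r.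
  rewrite !ltr_pM2l // leNgt pmulr_rlt0 // -leNgt ger_pMr // => y1.
  rewrite ltNge ger_pMr // y1 orbF.
  have f0 := frac_ge0 x; have f1 := frac_lt1 x.
  (* A far grid point y lies in (d, 1 - d) and either left of a - d or right of b + d; the two cases
     fix the sign of frac(x) - y. *)
  move=> /orP[] j1 /orP[] j2 j3; rewrite pmulr_rge0 // => y0; try by exfalso; lra.
  - have h : 0 <= Defs.frac x - y by lra.
    by rewrite ger0_norm //; lra.
  - have h : Defs.frac x - y <= 0 by lra.
    by rewrite ler0_norm //; lra.
move/le_trans; apply.
by rewrite sumr_const card_ord -[_ *+ K]mulr_natl mulrC divfK ?gt_eqF.
Qed.

(** The indicator of [a, b] is majorised by the kernels centred at the near grid points; summing
    over n, each of these has mean at most 1 + d, and there are at most K (b - a + 4d) + 3 of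
    them. *)
Lemma count_frac_in_le (R : realType) (t : nat -> R) (a b eps : R) :
  weyl_sums t -> 0 <= a -> a <= b -> b <= 1 -> 0 < eps ->
  exists N0 : nat, forall N, (N0 <= N)%N ->
    \sum_(n < N) (frac_in a b (t n))%:R <= (b - a + eps) * N%:R.
Proof.
move=> tW a0 ab b1 eps0.
(* Capping at 1 gives d <= 1/16, which controls the product eps d. With 3 <= dK and s <= dK the
   bound becomes c (1 - d) <= (b - a + 5d)(1 + d) N, and d = e / 16 leaves room to divide by 1 -
   d. *)
pose e := Num.min eps 1.
have e0 : 0 < e by rewrite lt_min eps0 ltr01.
have ee : e <= eps by rewrite ge_min lexx.
have e1 : e <= 1 by rewrite ge_min lexx orbT.
pose d := e / 16.
have d0 : 0 < d by rewrite /d; lra.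
have d2 : d <= 2^-1 by rewrite /d; lra.
pose s := 4 / (1 - cosT d).
have s0 : 0 < s by rewrite divr_gt0 // subr_gt0 cosT_lt1.
pose K := maxn (Num.truncn (3 / d)).+1 (Num.truncn (s / d)).+1.
have K0 : (0 < K)%N by rewrite leq_max.
have K3 : 3 <= d * K%:R by apply: le_mul_truncnS => //; exact: leq_maxl.
have Ks : s <= d * K%:R by apply: le_mul_truncnS => //; exact: leq_maxr.
have KR : 0 < K%:R :> R by rewrite ltr0n.
set near := near_arc K a b d.
have [N0 N0P] := mean_fejer_le tW K0 d0.
exists N0 => N /N0P NP.
set c := \sum_(n < N) _.
have c1 : c * (K%:R - s) <=
    \sum_(j < K | near j) \sum_(n < N) fejer K (t n - j%:R / K%:R).
  rewrite exchange_big mulr_suml /=; apply: ler_sum => n _.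
  exact: frac_in_le_fejer.
have c2 : \sum_(j < K | near j) \sum_(n < N) fejer K (t n - j%:R / K%:R) <=
    (\sum_(j < K) (near j)%:R) * ((1 + d) * N%:R).
  rewrite big_mkcond mulr_suml; apply: ler_sum => j _.
  by case: (near j); rewrite ?mul1r ?mul0r.
have c3 : \sum_(j < K) (near j)%:R <= K%:R * (b - a + 4 * d) + 3 :> R.
  have i1 := @count_itv_le R (K%:R * (a - d)) (K%:R * (b + d)) K.
  have i2 := @count_itv_le R 0 (K%:R * d) K.
  have i3 := @count_itv_le R (K%:R * (1 - d)) K%:R K.
  have {}i1 := i1 ltac:(rewrite ler_pM2l //; lra).
  have {}i2 := i2 ltac:(rewrite mulr_ge0 // ltW).
  have {}i3 := i3 ltac:(rewrite ger_pMr //; lra).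
  have : \sum_(j < K) (near j)%:R <=
      \sum_(j < K) (((K%:R * (a - d) <= j%:R <= K%:R * (b + d))%R%:R +
        ((0 : R) <= j%:R <= K%:R * d)%R%:R) +
        (K%:R * (1 - d) <= j%:R <= (K%:R : R))%R%:R) :> R.
    apply: ler_sum => j _; rewrite -!natrD ler_nat /near /near_arc.
    by do 3!case: (_ && _).
  by rewrite !big_split /=; lra.
have N0' : 0 <= (1 + d) * N%:R :> R by rewrite mulr_ge0 // addr_ge0 // ltW.
have c4 : c * (K%:R - s) <= (K%:R * (b - a + 4 * d) + 3) * ((1 + d) * N%:R).
  apply: le_trans c1 (le_trans c2 _); exact: ler_wpM2r.
have cge0 : 0 <= c by apply: sumr_ge0.
have c5 : c * (1 - d) * K%:R <= (b - a + 5 * d) * (1 + d) * N%:R * K%:R.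
  have : c * ((1 - d) * K%:R) <= c * (K%:R - s) by rewrite ler_wpM2l //; lra.
  have : (K%:R * (b - a + 4 * d) + 3) * ((1 + d) * N%:R) <=
         (K%:R * (b - a + 5 * d)) * ((1 + d) * N%:R) by rewrite ler_wpM2r //; lra.
  by lra.
rewrite ler_pM2r // in c5.
have d1 : 0 < 1 - d by lra.
rewrite -(ler_pM2r d1) (le_trans c5) // [leRHS]mulrAC ler_wpM2r //.
have de : d = e / 16 by [].
have l1 : (b - a) * d <= d by apply: ler_piMl (ltW d0) _; lra.
have l2 : d * d <= d by apply: ler_piMl (ltW d0) _; lra.
have l3 : eps * d <= eps / 16 by rewrite ler_pM2l //; lra.
by lra.
Qed.

(** * Cardinals as sums of indicators, and the limit *)

Lemma perm_fset_set (T : choiceType) (r : seq T) :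
  uniq r -> perm_eq (finmap.enum_fset (fset_set [set` r])) r.
Proof.
move=> ur; apply: uniq_perm => //.
move=> x; rewrite in_fset_set; last exact: finite_seq.
by apply/idP/idP; rewrite inE.
Qed.

Lemma card_seq (r : seq nat) : uniq r -> Defs.card [set` r] = size r.
Proof. by move=> ur; apply: perm_size; exact: perm_fset_set. Qed.

Lemma card_count (N : nat) (P : pred nat) :
  Defs.card [set n | (1 <= n <= N)%N /\ P n] = (\sum_(n < N) P n.+1)%N.
Proof.
have -> : [set n | (1 <= n <= N)%N /\ P n] = [set` [seq n <- iota 1 N | P n]].
  apply/seteqP; split=> n /=; rewrite mem_filter mem_iota add1n ltnS.
    by case=> -> ->.
  by case/andP.
rewrite card_seq ?filter_uniq ?iota_uniq // size_filter -sum1_count big_mkcond.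
rewrite (_ : iota 1 N = index_iota 1 N.+1) ?big_add1 ?big_mkord; last first.
  by rewrite /index_iota subn1.
by apply: eq_bigr => n _; case: (P _).
Qed.

(** Upper bounds on counts suffice: [0, a], [a, b] and [b, 1] cover [0, 1], so upper bounds for the
    outer two, each with error e / 2, give the lower bound for [a, b]. The outer intervals may be
    single points. *)
Lemma weyl_criterion (R : realType) (s : nat -> R) :
  weyl_sums (s \o succn) -> equidistributed_mod1 s.
Proof.
move=> sW a b a0 ab b1; apply/cvgrPdist_le => e e0.
have e2 : 0 < e / 2 by rewrite divr_gt0.
have [N1 N1P] := count_frac_in_le sW a0 (ltW ab) b1 e2.
have a1 : a <= 1 by rewrite (le_trans (ltW ab)).
have b0 : 0 <= b by rewrite (le_trans a0) ?ltW.
have [N2 N2P] := count_frac_in_le sW (lexx 0) a0 a1 e2.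
have [N3 N3P] := count_frac_in_le sW b0 b1 (lexx 1) e2.
exists (maxn N1 (maxn N2 (maxn N3 1))) => // N /=; rewrite !geq_max.
move=> /and4P[/N1P {}N1P /N2P {}N2P /N3P {}N3P N0].
have {}N0 : 0 < N%:R :> R by rewrite ltr0n.
rewrite (card_count N (fun n => frac_in a b (s n))) natr_sum.
set c := \sum_(n < N) _ in N1P *; rewrite -/c.
have cover : N%:R <= c + \sum_(n < N) (frac_in 0 a (s n.+1))%:R +
    \sum_(n < N) (frac_in b 1 (s n.+1))%:R.
  rewrite -{1}(card_ord N) -sumr_const -!big_split /=; apply: ler_sum => n _.
  rewrite /frac_in frac_ge0 (ltW (frac_lt1 _)) /=.
  rewrite -!natrD (ler_nat _ 1) andbT.
  case: (leP a (Defs.frac (s n.+1))) => [_|/ltW ->]; last by rewrite addnAC addn1.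
  by case: (leP (Defs.frac (s n.+1)) b) => [_|/ltW ->]; rewrite ?addn1.
have cE : c = (N%:R^-1 * c) * N%:R by rewrite mulrC mulVKf // gt_eqF.
rewrite ler_norml -(ler_pM2r N0) -[X in _ && X](ler_pM2r N0) !mulrBl -cE.
by apply/andP; split; lra.
Qed.

(** * From all integers to the subset *)

Lemma continuous_lin (R : realType) (c d : R) : continuous (fun x : R => c + d * x).
Proof.
by move=> x; apply: cvgD; [exact: cvg_cst|apply: cvgM; [exact: cvg_cst|exact: cvg_id]].
Qed.

Lemma continuous_cosT_lin (R : realType) (c d : R) :
  continuous (fun x : R => cosT (c + d * x)).
Proof.
have -> : (fun x : R => cosT (c + d * x)) =
    cos \o (fun x => 2 * pi * c + 2 * pi * d * x).
  by apply/funext => x; rewrite /cosT /= mulrDr mulrA.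
move=> x; apply: continuous_comp; [exact: continuous_lin|exact: continuous_cos].
Qed.

Lemma measurable_cosT_lin (R : realType) (c d : R) :
  measurable_fun setT (fun x : R => cosT (c + d * x)).
Proof. apply: continuous_measurable_fun; exact: continuous_cosT_lin. Qed.

Lemma integrable01_bounded (R : realType) (f : R -> R) (B : R) :
  measurable_fun setT f -> (forall x, `|f x| <= B) ->
  (@lebesgue_measure R).-integrable `[0, 1] (EFin \o f).
Proof.
move=> mf fB; apply: measurable_bounded_integrable => //.
- by rewrite /= lebesgue_measure_itv /= lte01 oppr0 adde0 ltry.
- exact: measurable_funTS.
- exists B; split; first exact: num_real.
  by move=> C BC x _ /=; rewrite (le_trans (fB x)) // ltW.
Qed.

Lemma integrable01_cosT (R : realType) (c d : R) :
  (@lebesgue_measure R).-integrable `[0, 1]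
    (EFin \o (fun x : R => cosT (c + d * x))).
Proof.
apply: (integrable01_bounded (B := 1)); first exact: measurable_cosT_lin.
by move=> x; exact: normr_cosT.
Qed.

(** For d <> 0 the antiderivative takes equal values at 0 and 1 by periodicity. *)
Lemma Rintegral_cosT (R : realType) (c : R) (d : int) :
  \int[lebesgue_measure]_(x in `[0, 1]) cosT (c + d%:~R * x) =
  if d == 0 then cosT c else 0 :> R.
Proof.
case: eqVneq => [->|d0].
  under eq_Rintegral do rewrite mul0r addr0.
  by rewrite Rintegral_cst //= lebesgue_measure_itv /= lte01 oppr0 adde0 mulr1.
have dR : d%:~R != 0 :> R by rewrite intr_eq0.
have pi0 : pi != 0 :> R by rewrite gt_eqF ?pi_gt0.
pose w : R := 2 * pi * d%:~R.
have w0 : w != 0 by rewrite !mulf_neq0.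
pose F x : R := sin (2 * pi * c + w * x) / w.
have dF (x : R) : is_derive x 1 F (cosT (c + d%:~R * x)).
  rewrite /F; apply: is_derive_eq.
  rewrite scaler0 !add0r /GRing.scale /= mulr1 mul1r mulrCA mulVf // mulr1 /cosT.
  by congr cos; rewrite /w; ring.
rewrite /Rintegral (@continuous_FTC2 R (fun x => cosT (c + d%:~R * x)) F) //=.
- rewrite /F mulr0 addr0 mulr1 -mulrBl.
  rewrite (_ : 2 * pi * c + w = 2 * pi * (c + d%:~R)); last by rewrite /w; ring.
  by rewrite -!/(sinT _) sinT_periodic subrr mul0r.
- by apply: continuous_subspaceT; exact: continuous_cosT_lin.
- split; first by move=> x _; exact: ex_derive.
  + apply: cvg_at_right_filter; apply: differentiable_continuous.
    exact/derivable1_diffP/ex_derive.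
  + apply: cvg_at_left_filter; apply: differentiable_continuous.
    exact/derivable1_diffP/ex_derive.
- by move=> x _; rewrite derive1E; exact: derive_val.
Qed.

(* If u > eps v then v = v^(p-1) v^(2-p) <= (u/eps)^(p-1) delta^(2-p), which is
   eps u^(p-1) for delta = eps^(p/(2-p)); otherwise u v <= eps v^2 already. *)
Lemma young_small (R : realType) (p eps : R) : 1 <= p < 2 -> 0 < eps ->
  exists2 delta : R, 0 < delta & forall u v : R, 0 <= u -> 0 <= v <= delta ->
    u * v <= eps * (u `^ p + v ^+ 2).
Proof.
move=> /andP[p1 p2] e0; exists (eps `^ (p / (2 - p))); first exact: powR_gt0.
move=> u v u0 /andP[v0 vd].
have p20 : 0 < 2 - p by rewrite subr_gt0.
have [uv|vu] := leP u (eps * v).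
  apply: le_trans (_ : eps * v * v <= _); first exact: ler_wpM2r.
  by rewrite mulrDr -mulrA -expr2 lerDr mulr_ge0 ?powR_ge0 // ltW.
have {}u0 : 0 < u by rewrite (le_lt_trans _ vu) // mulr_ge0 // ltW.
apply: le_trans (_ : eps * u `^ p <= _); last first.
  by rewrite ler_pM2l // lerDl sqr_ge0.
have [->|vn0] := eqVneq v 0; first by rewrite mulr0 mulr_ge0 ?powR_ge0 // ltW.
have vp : 0 < v by rewrite lt_neqAle eq_sym vn0.
have powD (x r t : R) : 0 < x -> x `^ (r + t) = x `^ r * x `^ t.
  by move=> x0; rewrite powRD //; apply/implyP => _; rewrite gt_eqF.
have -> : u `^ p = u * u `^ (p - 1).
  by rewrite -[X in _ = X * _](powRr1 (ltW u0)) -powD // addrC subrK.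
rewrite mulrCA ler_pM2l //.
have -> : v = v `^ (p - 1) * v `^ (2 - p).
  by rewrite -powD // (_ : p - 1 + (2 - p) = 1) ?powRr1 ?ltW //; ring.
have h1 : v `^ (p - 1) <= (u / eps) `^ (p - 1).
  apply: ge0_ler_powR; rewrite ?nnegrE ?subr_ge0 ?divr_ge0 ?(ltW u0) ?(ltW e0) //.
  by rewrite ler_pdivlMr // mulrC ltW.
have h2 : v `^ (2 - p) <= eps `^ p.
  apply: le_trans (_ : (eps `^ (p / (2 - p))) `^ (2 - p) <= _).
    by apply: ge0_ler_powR; rewrite ?nnegrE ?powR_ge0 ?(ltW p20).
  by rewrite -powRrM divfK // gt_eqF.
apply: le_trans (ler_pM (powR_ge0 _ _) (powR_ge0 _ _) h1 h2) _.
rewrite powRM ?invr_ge0 ?(ltW u0) ?(ltW e0) // -mulrA mulrC ler_wpM2r ?powR_ge0 //.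
rewrite -powR_inv1 ?(ltW e0) // -powRrM -powD //.
rewrite (_ : -1 * (p - 1) + p = 1); [by rewrite powRr1 // ltW | ring].
Qed.

Lemma measurable_sum_cosT (R : realType) (I : finType) (c d : I -> R) :
  measurable_fun setT (fun x : R => \sum_i cosT (c i + d i * x)).
Proof. by apply: measurable_sum => i; exact: measurable_cosT_lin. Qed.

Lemma normr_sum_cosT (R : realType) (I : finType) (c : I -> R) :
  `|\sum_i cosT (c i)| <= #|I|%:R.
Proof.
rewrite (le_trans (ler_norm_sum _ _ _)) // -sum1_card natr_sum.
by apply: ler_sum => i _; exact: normr_cosT.
Qed.

Lemma integrable01_sum_cosT (R : realType) (I : finType) (c d : I -> R) :
  (@lebesgue_measure R).-integrable `[0, 1]
    (EFin \o (fun x : R => \sum_i cosT (c i + d i * x))).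
Proof.
apply: integrable01_bounded; first exact: measurable_sum_cosT.
by move=> x; exact: normr_sum_cosT.
Qed.

Lemma Rintegral_sum_cosT (R : realType) (I : finType) (c : I -> R) (d : I -> int) :
  \int[lebesgue_measure]_(x in `[0, 1]) (\sum_i cosT (c i + (d i)%:~R * x)) =
  \sum_(i | d i == 0) cosT (c i) :> R.
Proof.
rewrite [RHS]big_mkcond /=; under [RHS]eq_bigr do rewrite -Rintegral_cosT.
rewrite /Rintegral; under eq_integral do rewrite -sumEFin.
rewrite integral_sum //; last by move=> i; exact: integrable01_cosT.
rewrite sum_fine // => i _; apply: integrable_fin_num => //.
exact: integrable01_cosT.
Qed.

Definition sqr_modulus {R : realType} (I : finType) (x : I -> R) : R :=
  (\sum_i cosT (x i)) ^+ 2 + (\sum_i sinT (x i)) ^+ 2.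

Lemma sqr_modulusE (R : realType) (I : finType) (x : I -> R) :
  sqr_modulus x = \sum_(ij : I * I) cosT (x ij.1 - x ij.2).
Proof. by rewrite /sqr_modulus sqr_sum_cosT pair_bigA. Qed.

Lemma sqr_modulus_ge0 (R : realType) (I : finType) (x : I -> R) :
  0 <= sqr_modulus x.
Proof. by rewrite addr_ge0 ?sqr_ge0. Qed.

Lemma sqr_modulus_linE (R : realType) (I : finType) (c : I -> R) (d : I -> int)
    (x : R) :
  sqr_modulus (fun i => c i + (d i)%:~R * x) =
  \sum_(ij : I * I) cosT ((c ij.1 - c ij.2) + (d ij.1 - d ij.2)%:~R * x).
Proof.
rewrite sqr_modulusE; apply: eq_bigr => ij _; congr cosT.
by rewrite rmorphB /=; ring.
Qed.

(** The double sum is the real part of a product of one exponential sum with the conjugate of the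
    other; the bound follows from (uw + vz)^2 + (uz - vw)^2 = (u^2 + v^2)(w^2 + z^2). *)
Lemma sum_cosTB_le (R : realType) (I J : finType) (x : I -> R) (y : J -> R) :
  `|\sum_(ij : I * J) cosT (y ij.2 - x ij.1)| <=
  Num.sqrt (sqr_modulus x) * Num.sqrt (sqr_modulus y).
Proof.
rewrite -(pair_bigA _ (fun i j => cosT (y j - x i))) /=.
set u := \sum_i cosT (x i); set v := \sum_i sinT (x i).
set w := \sum_j cosT (y j); set z := \sum_j sinT (y j).
have -> : \sum_i \sum_j cosT (y j - x i) = u * w + v * z.
  rewrite !big_distrlr -big_split /=; apply: eq_bigr => i _.
  by rewrite -big_split; apply: eq_bigr => j _; rewrite cosTB /=; ring.
rewrite -sqrtrM ?sqr_modulus_ge0 // -sqrtr_sqr ler_wsqrtr //.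
rewrite /sqr_modulus -/u -/v -/w -/z.
by have := sqr_ge0 (u * z - v * w); lra.
Qed.

(** Parseval: the frequencies are distinct, so only the diagonal survives. *)
Lemma Rintegral_sqr_modulus (R : realType) (L : nat) (c : 'I_L -> R) :
  \int[lebesgue_measure]_(x in `[0, 1])
    sqr_modulus (fun n : 'I_L => c n + (n : nat)%:~R * x) = L%:R :> R.
Proof.
under eq_Rintegral do rewrite sqr_modulus_linE.
rewrite Rintegral_sum_cosT.
rewrite -(pair_big_dep xpredT (fun i j : 'I_L => i%:Z - j%:Z == 0)
  (fun i j => cosT (c i - c j))) /=.
rewrite (eq_bigr (fun=> 1)) => [|i _]; first by rewrite sumr_const card_ord.
by rewrite (big_pred1 i) ?subrr ?cosT0 // => j; rewrite subr_eq0 eq_sym.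
Qed.

Lemma integrable01Zl (R : realType) (k : R) (f : R -> R) :
  (@lebesgue_measure R).-integrable `[0, 1] (EFin \o f) ->
  (@lebesgue_measure R).-integrable `[0, 1] (EFin \o (fun x => k * f x)).
Proof.
move=> fi; have -> : EFin \o (fun x => k * f x) = (fun x => k%:E * (EFin \o f) x)%E.
  by apply/funext => x; rewrite /= EFinM.
exact: integrableZl.
Qed.

Lemma integrable01D (R : realType) (f g : R -> R) :
  (@lebesgue_measure R).-integrable `[0, 1] (EFin \o f) ->
  (@lebesgue_measure R).-integrable `[0, 1] (EFin \o g) ->
  (@lebesgue_measure R).-integrable `[0, 1] (EFin \o (fun x => f x + g x)).
Proof.
move=> fi gi; have -> : EFin \o (fun x => f x + g x) = ((EFin \o f) \+ (EFin \o g))%E.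
  by apply/funext => x; rewrite /= EFinD.
exact: integrableD.
Qed.

(** After normalisation the integrand is at most M L eps (u^p + v^2). The moment hypothesis bounds
    the integral of u^p by C / L, and Parseval makes that of v^2 equal to 1 / L. *)
Lemma subset_sum_cosT_le (R : realType) (p eps delta C : R) (M L : nat)
    (b : 'I_M -> 'I_L) (g : nat -> R) (gamma : R) :
  (forall u v : R, 0 <= u -> 0 <= v <= delta ->
    u * v <= eps * (u `^ p + v ^+ 2)) ->
  0 <= p -> 0 < eps -> 0 < delta -> (0 < M)%N ->
  (forall beta gamma : R,
    `|\sum_(n < L) cosT (g n + n%:R * beta + gamma)| <= delta / 2 * L%:R) ->
  \int[lebesgue_measure]_(x in `[0, 1])
    (Num.sqrt (sqr_modulus (fun i => (b i)%:R * x)) `^ p) <= C * M%:R `^ p / L%:R ->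
  `|\sum_i cosT (g (b i) + gamma)| <= eps * (C + 1) * M%:R.
Proof.
move=> young p0 e0 d0 M0 gS momentC.
have L0 : (0 < L)%N by case: L b {gS momentC} => [b|//]; case: (b (Ordinal M0)).
have MR : 0 < M%:R :> R by rewrite ltr0n.
have LR : 0 < L%:R :> R by rewrite ltr0n.
pose f (x : R) (i : 'I_M) := 0 + (b i)%:~R * x.
pose F (x : R) (n : 'I_L) := (g n + gamma) + (n : nat)%:~R * x.
have fE (x : R) : sqr_modulus (fun i => (b i)%:R * x) = sqr_modulus (f x).
  by congr (_ ^+ 2 + _ ^+ 2); apply: eq_bigr => i _; rewrite /f add0r.
(* Orthogonality keeps only the pairs with n = b_i, exactly one for each i because b_i < L. *)
have TE : \sum_i cosT (g (b i) + gamma) = \int[lebesgue_measure]_(x in `[0, 1])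
    (\sum_(ij : 'I_M * 'I_L) cosT (F x ij.2 - f x ij.1)).
  pose c (ij : 'I_M * 'I_L) := g ij.2 + gamma.
  pose d (ij : 'I_M * 'I_L) := (ij.2)%:Z - (b ij.1)%:Z.
  have -> : (fun x => \sum_(ij : 'I_M * 'I_L) cosT (F x ij.2 - f x ij.1)) =
      (fun x => \sum_ij cosT (c ij + (d ij)%:~R * x)).
    apply/funext => x; apply: eq_bigr => ij _; congr cosT.
    by rewrite /F /f /c /d rmorphB /=; ring.
  rewrite Rintegral_sum_cosT.
  rewrite -(pair_big_dep xpredT (fun (i : 'I_M) (n : 'I_L) => n%:Z - (b i)%:Z == 0)
    (fun i n => cosT (g n + gamma))) /=.
  by apply: eq_bigr => i _; rewrite (big_pred1 (b i)) // => n; rewrite subr_eq0.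
(* The integration variable plays the role of [beta]. The real and imaginary parts are each at most
   delta L / 2, the latter through the phase -1/4. *)
have Fdelta (x : R) : sqr_modulus (F x) <= (delta * L%:R) ^+ 2.
  have gS' c : (\sum_n cosT (F x n + c)) ^+ 2 <= (delta / 2 * L%:R) ^+ 2.
    rewrite -[leLHS]real_normK ?num_real // ler_sqr ?nnegrE //; last first.
      by rewrite mulr_ge0 // divr_ge0 // ltW.
    have := gS x (gamma + c).
    rewrite (eq_bigr (fun n : 'I_L => cosT (F x n + c))) // => n _.
    by congr cosT; rewrite /F; ring.
  have A : (\sum_n cosT (F x n)) ^+ 2 <= (delta / 2 * L%:R) ^+ 2.
    by have := gS' 0; under eq_bigr do rewrite addr0.
  have B : (\sum_n sinT (F x n)) ^+ 2 <= (delta / 2 * L%:R) ^+ 2.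
    by under eq_bigr do rewrite sinTE; exact: gS'.
  rewrite /sqr_modulus.
  have : 0 <= (delta * L%:R) ^+ 2 by exact: sqr_ge0.
  by lra.
have pointwise (x : R) : `|\sum_(ij : 'I_M * 'I_L) cosT (F x ij.2 - f x ij.1)| <=
    M%:R * L%:R * eps *
    ((M%:R `^ p)^-1 * Num.sqrt (sqr_modulus (f x)) `^ p +
     L%:R^-1 ^+ 2 * sqr_modulus (F x)).
  apply: le_trans (sum_cosTB_le (f x) (F x)) _.
  pose u := Num.sqrt (sqr_modulus (f x)) / M%:R.
  pose v := Num.sqrt (sqr_modulus (F x)) / L%:R.
  have u0 : 0 <= u by rewrite divr_ge0 // sqrtr_ge0.
  have v0 : 0 <= v by rewrite divr_ge0 // sqrtr_ge0.
  have vd : v <= delta.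
    rewrite /v ler_pdivrMr // -(ger0_norm (mulr_ge0 (ltW d0) (ltW LR))).
    by rewrite -sqrtr_sqr ler_wsqrtr.
  have -> : L%:R^-1 ^+ 2 * sqr_modulus (F x) = v ^+ 2.
    by rewrite /v exprMn sqr_sqrtr ?sqr_modulus_ge0 // mulrC.
  have -> : (M%:R `^ p)^-1 * Num.sqrt (sqr_modulus (f x)) `^ p = u `^ p.
    rewrite /u powRM ?sqrtr_ge0 ?invr_ge0 // -[X in _ = _ * X `^ _]powR_inv1 //.
    by rewrite -powRrM mulN1r powRN mulrC.
  rewrite -[leRHS]mulrA.
  apply: le_trans (_ : M%:R * L%:R * (u * v) <= _).
    rewrite /u /v le_eqVlt; apply/orP; left; apply/eqP; field.
    by rewrite !gt_eqF.
  by rewrite ler_pM2l ?mulr_gt0 //; apply: young; rewrite ?v0.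
have mf : measurable_fun setT (fun x : R => Num.sqrt (sqr_modulus (f x)) `^ p).
  apply: (measurableT_comp (measurable_powR p)).
  apply: measurableT_comp.
    by apply: continuous_measurable_fun; exact: sqrt_continuous.
  by under eq_fun do rewrite sqr_modulus_linE; exact: measurable_sum_cosT.
have if1 : (@lebesgue_measure R).-integrable `[0, 1]
    (EFin \o (fun x : R => Num.sqrt (sqr_modulus (f x)) `^ p)).
  (* The trivial bound by the number of pairs, used only for integrability. *)
  apply: (integrable01_bounded (B := Num.sqrt #|{: 'I_M * 'I_M}|%:R `^ p)) => //.
  move=> x; rewrite ger0_norm ?powR_ge0 //.
  apply: ge0_ler_powR; rewrite ?nnegrE ?sqrtr_ge0 // ler_wsqrtr // sqr_modulusE.
  by rewrite (le_trans (ler_norm _)) // normr_sum_cosT.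
have if2 : (@lebesgue_measure R).-integrable `[0, 1]
    (EFin \o (fun x : R => sqr_modulus (F x))).
  have -> : (fun x => sqr_modulus (F x)) = (fun x =>
      \sum_(ij : 'I_L * 'I_L) cosT ((g ij.1 + gamma) - (g ij.2 + gamma) +
        ((ij.1)%:Z - (ij.2)%:Z)%:~R * x)).
    by apply/funext => x; rewrite /F sqr_modulus_linE.
  exact: integrable01_sum_cosT.
have iG : (@lebesgue_measure R).-integrable `[0, 1] (EFin \o (fun x : R =>
    \sum_(ij : 'I_M * 'I_L) cosT (F x ij.2 - f x ij.1))).
  have -> : (fun x => \sum_(ij : 'I_M * 'I_L) cosT (F x ij.2 - f x ij.1)) =
      (fun x => \sum_(ij : 'I_M * 'I_L) cosT (g ij.2 + gamma +
         ((ij.2)%:Z - (b ij.1)%:Z)%:~R * x)).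
    apply/funext => x; apply: eq_bigr => ij _; congr cosT.
    by rewrite /F /f rmorphB /=; ring.
  exact: integrable01_sum_cosT.
rewrite TE (le_trans (le_normr_Rintegral _ iG)) //.
have mI : measurable (`[0, 1]%classic : set R) by [].
have i1 : (@lebesgue_measure R).-integrable `[0, 1]
    (EFin \o (fun x => (M%:R `^ p)^-1 * Num.sqrt (sqr_modulus (f x)) `^ p)).
  exact: integrable01Zl.
have i2 : (@lebesgue_measure R).-integrable `[0, 1]
    (EFin \o (fun x => L%:R^-1 ^+ 2 * sqr_modulus (F x))).
  exact: integrable01Zl.
have i12 : (@lebesgue_measure R).-integrable `[0, 1]
    (EFin \o (fun x => (M%:R `^ p)^-1 * Num.sqrt (sqr_modulus (f x)) `^ p +
                       L%:R^-1 ^+ 2 * sqr_modulus (F x))).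
  exact: integrable01D.
apply: (@le_trans _ _ (\int[lebesgue_measure]_(x in `[0, 1]) (M%:R * L%:R * eps *
    ((M%:R `^ p)^-1 * Num.sqrt (sqr_modulus (f x)) `^ p +
     L%:R^-1 ^+ 2 * sqr_modulus (F x))))).
  apply: le_Rintegral => //; first exact: integrable_norm.
  exact: integrable01Zl.
rewrite RintegralZl // RintegralD // !RintegralZl // Rintegral_sqr_modulus.
under [X in _ * (_ * X + _) <= _]eq_Rintegral do rewrite -fE.
have Mp : 0 < M%:R `^ p :> R by rewrite powR_gt0.
set W := \int[_]_(x in _) _ in momentC *.
have WE : (M%:R `^ p)^-1 * W <= C / L%:R.
  by rewrite mulrC ler_pdivrMr // mulrAC.
apply: le_trans (_ : M%:R * L%:R * eps * (C / L%:R + L%:R^-1 ^+ 2 * L%:R) <= _).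
  by rewrite ler_pM2l ?mulr_gt0 // lerD2r.
rewrite le_eqVlt; apply/orP; left; apply/eqP; field.
by rewrite gt_eqF.
Qed.

(** * Finite enumeration of the subset, and the conclusion *)

Lemma sum_complex (R : rcfType) (I : Type) (r : seq I) (x y : I -> R) :
  \sum_(i <- r) Complex (x i) (y i) =
  Complex (\sum_(i <- r) x i) (\sum_(i <- r) y i).
Proof. by elim: r => [|i r IH]; rewrite ?big_nil // !big_cons IH. Qed.

Lemma normc_exp_sum (R : realType) (A : set nat) (N alpha : R) (M : nat)
    (b : 'I_M -> nat) :
  injective b -> upto A N = range b ->
  ComplexField.Normc.normc (exp_sum A N alpha) =
  Num.sqrt (sqr_modulus (fun i => (b i)%:R * alpha)).
Proof.
move=> b_inj AN; have -> : exp_sum A N alpha =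
    \sum_(i < M) e_unit ((b i)%:R * alpha).
  have rE : upto A N = [set` codom b].
    rewrite AN; apply/seteqP; split=> n /=; first by case=> i _ <-; exact: codom_f.
    by case/codomP => i ->; exists i.
  have ur : uniq (codom b) by rewrite map_inj_uniq ?enum_uniq.
  rewrite /exp_sum rE fsbig_finite /=; last exact: finite_seq.
  by rewrite (perm_big _ (perm_fset_set ur)) /= big_image.
by rewrite /e_unit sum_complex.
Qed.

Lemma card_upto (R : realType) (A : set nat) (N : R) (M : nat) (b : 'I_M -> nat) :
  injective b -> upto A N = range b -> Defs.card (upto A N) = M.
Proof.
move=> b_inj ->; have -> : range b = [set` codom b].
  apply/seteqP; split=> n /=; first by case=> i _ <-; exact: codom_f.
  by case/codomP => i ->; exists i.
by rewrite card_seq ?size_codom ?card_ord // map_inj_uniq ?enum_uniq.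
Qed.

Theorem theorem1p4 (R : realType) (p : R) (A : set nat) (a : nat -> nat)
    (k : nat) (alpha : 'I_k.+1 -> R)
    (A_pos : forall n : nat, A n -> (1 <= n)%N)
    (A_enum : A = [set a n | n in [set n : nat | (1 <= n)%N]])
    (a_incr : forall m n : nat, (1 <= m)%N -> (m < n)%N -> (a m < a n)%N)
    (p_bounds : 1 <= p < 2)
    (A_subconvex : strongly_subconvex p A)
    (k_ge2 : (2 <= k)%N)
    (alpha_irr : exists j : 'I_k.+1, (2 <= j)%N /\ irrational (alpha j)) :
  let psi := fun x : R => \sum_(j < k.+1) alpha j * x ^+ j in
  equidistributed_mod1 (fun n : nat => psi (a n)%:R).
Proof.
move=> psi; apply: weyl_criterion => h h0 eps eps0.
have [_ _ [C [N0 [C0 momentC]]]] := A_subconvex.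
have p0 : 0 <= p by case/andP: p_bounds => p1 _; rewrite (le_trans _ p1).
have a_ge1 n : (1 <= n)%N -> (1 <= a n)%N.
  by move=> n1; apply: A_pos; rewrite A_enum; exists n.
have a_ge n : (1 <= n)%N -> (n <= a n)%N.
  elim: n => // -[_ _|n IH _]; first exact: a_ge1.
  by rewrite (leq_trans _ (a_incr n.+1 n.+2 _ _)) // ltnS IH.
(* The polynomial h psi, whose sums Weyl's criterion requires; since h > 0, irrational coefficients
   remain irrational. *)
pose P : {poly R} := \poly_(j < k.+1) (h%:R * alpha (inord j)).
have PE (n : nat) : P.[n%:R] = h%:R * psi n%:R.
  rewrite horner_poly mulr_sumr; apply: eq_bigr => j _.
  by rewrite inord_val mulrA.
have Pirr : exists2 j, (2 <= j)%N & irrational P`_j.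
  have [j [j2 jirr]] := alpha_irr; exists j => //.
  by rewrite coef_poly ltn_ord inord_val => /(rational_cancelM h0) /jirr.
(* The moment constant doubles when 1 / a_M is replaced by 2 / L below, so the final bound is eps'
   (2C + 1) M. *)
pose eps' := eps / (C * 2 + 1).
have C1 : 0 < C * 2 + 1 by rewrite addr_gt0 ?mulr_gt0.
have eps'0 : 0 < eps' by rewrite divr_gt0.
have [delta delta0 young] := young_small p_bounds eps'0.
have [N1 N1P] := weyl_poly_twisted Pirr (divr_gt0 delta0 (ltr0n R 2)).
exists (maxn 1 (maxn N1 (Num.truncn N0).+1)) => M.
rewrite !geq_max => /and3P[M0 N1M N0M] gamma.
(* Sums over n < L start at n = 0, so they reach a_M only with this extra unit. *)
pose L := (a M).+1.
have ML : (M <= L)%N by rewrite ltnW // ltnS a_ge.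
have a_le i j : (1 <= i)%N -> (i <= j)%N -> (a i <= a j)%N.
  by move=> i1; rewrite leq_eqVlt => /predU1P[-> //|ij]; rewrite ltnW // a_incr.
have bL (i : 'I_M) : (a i.+1 < L)%N by rewrite ltnS a_le.
pose b i := Ordinal (bL i).
have b_inj : injective (fun i : 'I_M => a i.+1).
  move=> i j aij; apply/val_inj => /=; case: (ltngtP i j) => // ij.
    by have := a_incr i.+1 j.+1 isT ij; rewrite aij ltnn.
  by have := a_incr j.+1 i.+1 isT ij; rewrite aij ltnn.
(* Taking N = a_M makes A(N) consist of exactly the first M elements; the index shift reflects that
   the enumeration starts at 1. *)
have AE : upto A ((a M)%:R : R) = range (fun i : 'I_M => a i.+1).
  rewrite /upto A_enum; apply/seteqP; split=> n /=.
    case=> -[[//|m] _ <-] [_]; rewrite ler_nat => aM.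
    have mM : (m < M)%N.
      by rewrite ltnNge; apply/negP => Mm; have := a_incr M m.+1 M0 Mm; lia.
    by exists (Ordinal mM).
  case=> i _ <-; split; first by exists i.+1.
  by split; [exact: a_ge1|rewrite ler_nat a_le].
have aM0 : 0 < (a M)%:R :> R by rewrite ltr0n a_ge1.
have := momentC (a M)%:R.
rewrite /moment (card_upto b_inj AE).
under eq_Rintegral do rewrite (normc_exp_sum _ b_inj AE).
move=> {}momentC.
have gS beta gam : `|\sum_(n < L) cosT (P.[n%:R] + n%:R * beta + gam)| <=
    delta / 2 * L%:R by apply: N1P; exact: leq_trans ML.
have -> : eps = eps' * (C * 2 + 1) by rewrite /eps' divfK // gt_eqF.
have -> : \sum_(n < M) cosT (h%:R * (psi (a n.+1)%:R) + gamma) =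
    \sum_(i < M) cosT (P.[(b i)%:R] + gamma).
  by apply: eq_bigr => i _; rewrite PE.
apply: (@subset_sum_cosT_le R p _ delta _ M L b (fun n => P.[n%:R]) gamma young) => //.
(* The moment bound is available because a_M >= M > N0. *)
have N0a : N0 <= (a M)%:R.
  rewrite (le_trans (ltW (truncnS_gt N0))) // ler_nat.
  by rewrite (leq_trans N0M) // a_ge.
rewrite (le_trans (momentC N0a)) //.
rewrite -mulrA -mulrA ler_pM2l // mulrC mulrCA ler_wpM2l ?powR_ge0 //.
(* What remains is L = a_M + 1 <= 2 a_M, which holds because a_M >= 1. *)
rewrite ler_pdivlMr ?ltr0n // mulrC ler_pdivrMr //.
by rewrite -natrM ler_nat /L; have := a_ge1 M M0; lia.
Qed.
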